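(* Let $\Phi,\Phi_1$ be admissible functions. (i) If for all $\alpha\in(1,\infty)$ there exists $\Delta>0$ such that for all $\delta\in(0,\Delta)$ we have $$(\ast)\qquad \Phi_1(\delta)\le\left(\Phi(\delta^{1/\alpha})\right)^{1/\alpha}$$ (which is the case if, for example, there exists $C\in(0,\infty)$ such that $\limsup_{\delta\to0^+}\frac{\Phi_1(C\delta)}{\Phi(\delta)}<\infty$), then $\Phi_1\preceq\Phi$. If we only assume that for all $\alpha\in(1,\infty)$ and $\delta_0>0$ there exists $\delta\in(0,\delta_0)$ such that $(\ast)$ holds, then $\underline{\dim}^{\Phi_1}F\le\overline{\dim}^\Phi F$ for every non-empty totally bounded subset $F$ with finite Assouad dimension of every uniformly perfect metric space with more than one point. (ii) If for all $\alpha\in(1,\infty)$ there exists $\Delta>0$ such that for all $\delta\in(0,\Delta)$ $$\left(\Phi(\delta^\alpha)\right)^\alpha\le\Phi_1(\delta)\le\left(\Phi(\delta^{1/\alpha})\right)^{1/\alpha},$$ then $\Phi\equiv\Phi_1$.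
   Context: For a subset $U$ of a metric space, $|U|$ denotes its diameter, and $B(x,r)$ is the open ball. Convention: $\inf\varnothing=\infty$. A metric space $X$ is uniformly perfect if there is $c\in(0,1)$ such that $B(x,R)\setminus B(x,cR)\neq\varnothing$ for all $x\in X$ and $0<R<|X|$. $N_\delta(F)$ is the smallest number of open balls of radius $\delta/2$ with centres in $F$ needed to cover $F$; $F$ is totally bounded if $N_\delta(F)<\infty$ for all $\delta>0$. A function $\Phi\colon(0,\Delta)\to\mathbb{R}$ (for some $\Delta>0$) is admissible if it is monotonic, $0<\Phi(\delta)\le\delta$ for all $\delta\in(0,\Delta)$, and $\Phi(\delta)/\delta\to0$ as $\delta\to0^+$. For a non-empty totally bounded $F\subseteq X$ and admissible $\Phi$, the upper $\Phi$-intermediate dimension $\overline{\dim}^\Phi F$ is the infimum of all $s\ge0$ such that for all $\epsilon>0$ there exists $\delta_0\in(0,1]$ (with $(0,\delta_0)$ contained in the domain of $\Phi$) such that for all $\delta\in(0,\delta_0)$ there is a finite or countable cover $\{U_1,U_2,\dots\}$ of $F$ by subsets of $X$ with $\Phi(\delta)\le|U_i|\le\delta$ for all $i$ and $\sum_i|U_i|^s\le\epsilon$. The lower $\Phi$-intermediate dimension $\underline{\dim}^\Phi F$ is the infimum of all $s\ge0$ such that for all $\epsilon>0$ and $\delta_0\in(0,1]$ there exist $\delta\in(0,\delta_0)$ (in the domain of $\Phi$) and such a cover of $F$ with $\Phi(\delta)\le|U_i|\le\delta$ for all $i$ and $\sum_i|U_i|^s\le\epsilon$. The Assouad dimension $\dim_{\mathrm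 A}F$ is the infimum of all $a$ for which there exists $C>0$ such that $N_r(B(x,R)\cap F)\le C(R/r)^a$ for all $x\in F$ and $0<r<R$. For admissible $\Phi_1,\Phi_2$, write $\Phi_1\preceq\Phi_2$ if $\overline{\dim}^{\Phi_1}F\le\overline{\dim}^{\Phi_2}F$ and $\underline{\dim}^{\Phi_1}F\le\underline{\dim}^{\Phi_2}F$ for every non-empty totally bounded subset $F$ with $\dim_{\mathrm A}F<\infty$ of every uniformly perfect metric space $X$ with more than one point. Write $\Phi_1\equiv\Phi_2$ if $\Phi_1\preceq\Phi_2$ and $\Phi_2\preceq\Phi_1$. *)

(* Defs.v *)
From mathcomp Require Import all_boot all_order all_algebra finmap.
#[warning="-warn-library-file-internal-analysis"]
From mathcomp Require Import unstable.
From mathcomp Require Import all_classical all_reals all_analysis.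

Set Implicit Arguments.
Unset Strict Implicit.
Unset Printing Implicit Defensive.

Import Order.TTheory GRing.Theory Num.Theory.
Import numFieldNormedType.Exports.

Local Open Scope classical_set_scope.
Local Open Scope ring_scope.

Section metric_notions.
Context {R : realType} {X : metricType R}.
Implicit Types (U F : set X) (d r s a : R).

(* The element 0 is included so that the empty set has diameter 0, not -oo. *)
Definition diam U : \bar R :=
  ereal_sup (0%E |` [set (mdist p.1 p.2)%:E | p in U `*` U]).

(* Infimum of the cardinalities of the finite sets of centres; by
   [ereal_inf set0 = +oo] it is +oo when no finite set of centres works. *)
Definition covering_number d F : \bar R :=
  ereal_inf [set (#|` A|%:R)%:E | A in
    [set A : {fset X} | [set` A] `<=` F /\
                        F `<=` \bigcup_(x in [set` A]) ball x (d / 2)]].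

Definition totally_bounded F : Prop :=
  forall d, 0 < d -> (covering_number d F < +oo)%E.

Definition assouad_dim F : \bar R :=
  ereal_inf [set a%:E | a in
    [set a | exists2 C : R, 0 < C &
       forall (x : X) (r r' : R), F x -> 0 < r -> r < r' ->
         (covering_number r (ball x r' `&` F) <= (C * (r' / r) `^ a)%:E)%E]].

End metric_notions.

Definition uniformly_perfect {R : realType} (X : metricType R) : Prop :=
  exists2 c : R, 0 < c < 1 &
    forall (x : X) (r : R), 0 < r -> (r%:E < diam [set: X])%E ->
      ball x r `\` ball x (c * r) !=set0.

(* A function on ]0, adm_bound[, represented by a total function whose values
   outside this interval are irrelevant. *)
Record admissible (R : realType) := Admissible {
  adm_bound : R ;
  adm_fun :> R -> R ;
  adm_bound_gt0 : 0 < adm_bound ;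
  adm_monotonic : monotonic `]0, adm_bound[ adm_fun ;
  adm_itv : forall d, 0 < d < adm_bound -> 0 < adm_fun d <= d ;
  adm_cvg : adm_fun d / d @[d --> 0^'+] --> (0 : R) }.

Definition adm_dom {R : realType} (Phi : admissible R) : set R :=
  `]0, adm_bound Phi[.

Section intermediate_dimensions.
Context {R : realType} {X : metricType R}.
Implicit Types (F : set X) (Phi : admissible R) (d s eps : R).

(* The finite or countable cover is the family (U i) for i in J. *)
Definition has_cover Phi F d s eps : Prop :=
  exists (J : set nat) (U : nat -> set X),
    [/\ F `<=` \bigcup_(i in J) U i,
        forall i, J i -> ((Phi d)%:E <= diam (U i) <= d%:E)%E &
        (\esum_(i in J) poweR (diam (U i)) s <= eps%:E)%E].

Definition upper_dim Phi F : \bar R :=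
  ereal_inf [set s%:E | s in
    [set s | 0 <= s /\ forall eps, 0 < eps ->
       exists d0, [/\ 0 < d0 <= 1, `]0, d0[ `<=` adm_dom Phi &
         forall d, 0 < d < d0 -> has_cover Phi F d s eps]]].

Definition lower_dim Phi F : \bar R :=
  ereal_inf [set s%:E | s in
    [set s | 0 <= s /\ forall eps d0, 0 < eps -> 0 < d0 <= 1 ->
       exists d, [/\ 0 < d < d0, adm_dom Phi d & has_cover Phi F d s eps]]].

End intermediate_dimensions.

Definition dim_preceq {R : realType} (Phi1 Phi2 : admissible R) : Prop :=
  forall X : metricType R, uniformly_perfect X -> (exists x y : X, x <> y) ->
  forall F : set X, F !=set0 -> totally_bounded F ->
    (assouad_dim F < +oo)%E ->
    (upper_dim Phi1 F <= upper_dim Phi2 F)%E /\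
    (lower_dim Phi1 F <= lower_dim Phi2 F)%E.

Definition dim_equiv {R : realType} (Phi1 Phi2 : admissible R) : Prop :=
  dim_preceq Phi1 Phi2 /\ dim_preceq Phi2 Phi1.

(* The two power comparisons at the point d, including that every argument lies
   in the domain of the function it is fed to. *)
Definition root_bound {R : realType} (Phi1 Phi : admissible R) (a d : R) : Prop :=
  [/\ adm_dom Phi1 d, adm_dom Phi (d `^ a^-1) &
      Phi1 d <= Phi (d `^ a^-1) `^ a^-1].

Definition power_bound {R : realType} (Phi Phi1 : admissible R) (a d : R) : Prop :=
  [/\ adm_dom Phi (d `^ a), adm_dom Phi1 d & Phi (d `^ a) `^ a <= Phi1 d].

(* Main.v *)
Require Import Defs.
From mathcomp Require Import all_boot all_order all_algebra finmap.
From mathcomp Require Import all_classical all_reals all_analysis.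
From mathcomp Require Import ring lra.

Import Order.TTheory GRing.Theory Num.Theory.
Import numFieldNormedType.Exports.

Local Open Scope classical_set_scope.
Local Open Scope ring_scope.

(* Let s < t, let al > 1 be close to 1, and put d' = d^(1/al). A cover for Phi
   at scale d' with finite s-cost is turned piece by piece into a cover for Phi1 at
   scale d.
   - If |U| > d, the finite Assouad dimension a covers U by C (|U| / d)^a balls
     of diameter at most d / 2, each of which is enlarged by one point, using
     uniform perfectness, to get a diameter in [c d / 2, d]. As |U|^al <= d, the
     t-cost is at most a constant times |U|^(t - a (al - 1)) <= |U|^s.
   - If Phi1 d <= |U| <= d, then U is kept.
   - If |U| < Phi1 d, then U is enlarged by one point to a diameter comparable
     to Phi1 d. As Phi1 d <= Phi(d')^(1/al) <= |U|^(1/al), the t-cost is at most a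
     constant times |U|^(t/al) <= |U|^s. *)

(** * Diameters, enlargement by one point, and covers by balls *)

Section diameter.
Context {R : realType} {X : metricType R}.
Implicit Types (U V F : set X) (x y : X) (e u r rho c a C : R).

Lemma diam_ge0 U : (0 <= diam U)%E.
Proof. by apply: ereal_sup_ubound; left. Qed.

Lemma mdist_le_diam U x y : U x -> U y -> ((mdist x y)%:E <= diam U)%E.
Proof. by move=> Ux Uy; apply: ereal_sup_ubound; right; exists (x, y). Qed.

Lemma diam_le U e : 0 <= e ->
  (forall x y, U x -> U y -> mdist x y <= e) -> (diam U <= e%:E)%E.
Proof.
move=> e0 Ue; apply: ge_ereal_sup => _ [->|[[x y] [/= Ux Uy] <-]].
  by rewrite lee_fin.
by rewrite lee_fin Ue.
Qed.

Lemma diam_gt0_nonempty U : (0 < diam U)%E -> U !=set0.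
Proof.
move=> U0; apply/set0P/eqP => U_eq0; move: U0.
by rewrite ltNge diam_le// U_eq0.
Qed.

(* It suffices to add to [U] one point whose distance to some point of [U] lies
   in [rho, rho / c[. *)
Lemma uniformly_perfect_enlarge c U u rho :
  0 < c ->
  (forall x r, 0 < r -> (r%:E < diam [set: X])%E ->
     ball x r `\` ball x (c * r) !=set0) ->
  0 < rho -> ((rho / c)%:E < diam [set: X])%E ->
  U !=set0 -> (diam U <= u%:E)%E ->
  exists2 V, U `<=` V & (rho%:E <= diam V <= (u + rho / c)%:E)%E.
Proof.
move=> c0 Xc rho0 rhoX [x Ux] Uu.
have r0 : 0 < rho / c by rewrite divr_gt0.
have [y []] := Xc x _ r0 rhoX.
rewrite [c * _]mulrC divfK ?gt_eqF// !ballEmdist/= => xy /negP.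
rewrite -leNgt => rhoxy.
have u0 : 0 <= u by rewrite -lee_fin (le_trans (diam_ge0 U)).
have Ule z z' : U z -> U z' -> mdist z z' <= u.
  by move=> Uz Uz'; rewrite -lee_fin (le_trans _ Uu)// mdist_le_diam.
exists (y |` U); first exact: subsetUr.
apply/andP; split.
  by apply: le_trans (mdist_le_diam _ x y _ _); [|right|left].
have near_y z : U z -> mdist z y <= u + rho / c.
  move=> Uz; rewrite (le_trans (metric_triangle z x y))//.
  by rewrite lerD ?Ule// ltW.
apply: diam_le => [|z z']; first by rewrite addr_ge0// ltW.
move=> [->|Uz] [->|Uz'].
- by rewrite mdistxx addr_ge0// ltW.
- by rewrite metric_sym near_y.
- exact: near_y.
- by rewrite (le_trans (Ule _ _ Uz Uz'))// lerDl ltW.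
Qed.

Lemma diam_ball x r : 0 <= r -> (diam (ball x (r / 2)) <= r%:E)%E.
Proof.
move=> r0; apply: diam_le => // y z; rewrite !ballEmdist/= => xy xz.
rewrite (le_trans (metric_triangle y x z))// [r]splitr lerD//.
  by rewrite metric_sym ltW.
exact: ltW.
Qed.

(** If [U] meets [F] at [x], then [U] lies in the ball of radius [2 * u] about [x]. The factor 2 in
    front of [C] makes the bound strictly larger than the covering number, an infimum, so some
    finite set of centres stays below it. *)
Lemma assouad_cover C a F U u r :
  0 < C ->
  (forall x r r', F x -> 0 < r -> r < r' ->
     (covering_number r (ball x r' `&` F) <= (C * (r' / r) `^ a)%:E)%E) ->
  0 < r -> r < 2 * u -> U !=set0 -> (diam U <= u%:E)%E ->
  exists n (f : nat -> X), n%:R <= 2 * C * (2 * u / r) `^ a /\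
    U `&` F `<=` \bigcup_(k in `I_n) ball (f k) (r / 2).
Proof.
move=> C0 Ca r0 ru [x0 _] Uu.
have u0 : 0 < u by rewrite -(@pmulr_rgt0 _ 2)// (lt_trans r0).
have M0 : 0 < C * (2 * u / r) `^ a.
  by rewrite mulr_gt0// powR_gt0// divr_gt0// mulr_gt0.
(* The Assouad bound needs a centre in [F]; if [U] contains none, zero balls suffice. *)
have [UF0|/set0P[x [Ux Fx]]] := eqVneq (U `&` F) set0.
  exists 0%N, (fun=> x0); split; first by rewrite !mulr_ge0 ?powR_ge0 ?ltW.
  by rewrite UF0.
have : (covering_number r (ball x (2 * u) `&` F)
        < (2 * C * (2 * u / r) `^ a)%:E)%E.
  rewrite (le_lt_trans (Ca x r (2 * u) Fx r0 ru))// lte_fin.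
  lra.
move=> /ereal_inf_lt[_ [A [_ FA] <-]]; rewrite lte_fin => AM.
exists #|` A|%N, (nth x (enum_fset A)); split.
  exact: ltW.
move=> y [Uy Fy].
have [|z /= zA yz] := FA y.
  split => //; rewrite ballEmdist/=; apply: (@le_lt_trans _ _ u).
    by rewrite -lee_fin (le_trans _ Uu)// mdist_le_diam.
  by rewrite ltr_pMl// ltr1n.
exists (index z (enum_fset A)); first by rewrite /= index_mem.
by rewrite nth_index.
Qed.

End diameter.

(** * Refining a cover piece by piece *)

Lemma esum_mulrl_le {R : realType} {T : choiceType} (I : set T)
    (a : T -> \bar R) (k : R) : 0 <= k -> (forall i, (0 <= a i)%E) ->
  (\esum_(i in I) (k%:E * a i) <= k%:E * \esum_(i in I) a i)%E.
Proof.
move=> k0 a0; apply: ge_ereal_sup => _ [A IA <-].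
rewrite -ge0_mule_fsumr// lee_wpmul2l ?lee_fin//.
by apply: esum_ge; exists A.
Qed.

Section refinement.
Context {R : realType} {X : metricType R}.
Implicit Types (F U : set X) (Phi : admissible R).

(* The part of [U] in [F] has a finite cover that is permitted at scale [d] and
   whose [t]-cost is at most [k] times the [s]-cost of [U]. *)
Definition refinable Phi F d s t k U : Prop :=
  exists n (V : nat -> set X),
    [/\ U `&` F `<=` \bigcup_(j in `I_n) V j,
        forall j, (j < n)%N -> ((Phi d)%:E <= diam (V j) <= d%:E)%E &
        (\sum_(j < n) poweR (diam (V j)) t <= k%:E * poweR (diam U) s)%E].

(** All refinements are chosen at once and listed over pairs [(i, j)], coded as natural numbers; the
    double sum of their costs is bounded row by row. *)
Lemma has_cover_refine Phi Phi1 F d d1 s t k eps : 0 <= k ->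
  (forall U, ((Phi d)%:E <= diam U <= d%:E)%E -> refinable Phi1 F d1 s t k U) ->
  has_cover Phi F d s eps -> has_cover Phi1 F d1 t (k * eps).
Proof.
move=> k0 ref [J [U [FU Ud Us]]].
have /choice[nV nVP] i : exists nV : nat * (nat -> set X), J i ->
    [/\ U i `&` F `<=` \bigcup_(j in `I_nV.1) nV.2 j,
        forall j, (j < nV.1)%N ->
          ((Phi1 d1)%:E <= diam (nV.2 j) <= d1%:E)%E &
        (\sum_(j < nV.1) poweR (diam (nV.2 j)) t
          <= k%:E * poweR (diam (U i)) s)%E].
  have [Ji|nJi] := pselect (J i); last by exists (0%N, fun=> set0).
  by have [n [V nV]] := ref _ (Ud i Ji); exists (n, V).
pose P := J `*`` (fun i => `I_(nV i).1).
(* Numbers that code no pair get the empty set; they lie outside the index set of the new cover. *)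
pose V (m : nat) :=
  if (choice.unpickle m : option (nat * nat)%type) is Some (i, j)
  then (nV i).2 j else set0.
have VE p : V (choice.pickle p) = (nV p.1).2 p.2.
  by rewrite /V choice.pickleK; case: p.
exists (choice.pickle @` P), V; split.
- move=> x Fx; have [i Ji Uix] := FU x Fx.
  have [/(_ x)[//|j jn Vx _ _]] := nVP i Ji.
  by exists (choice.pickle (i, j)); [exists (i, j)|rewrite VE].
- move=> _ [[i j] [/= Ji jn] <-].
  by rewrite VE; have [_ + _] := nVP i Ji; exact.
- rewrite (@reindex_esum _ _ _ P _ choice.pickle); last first.
    by apply: inj_bij => x y _ _; exact: (pcan_inj choice.pickleK).
  under eq_esum do rewrite VE.
  rewrite -(@esum_esum _ _ _ _ _ (fun i j => poweR (diam ((nV i).2 j)) t));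
    last by move=> *; exact: poweR_ge0.
  apply: (@le_trans _ _ (\esum_(i in J) (k%:E * poweR (diam (U i)) s))%E).
    apply: le_esum => i Ji; have [_ _] := nVP i Ji.
    rewrite esum_fset; last 2 first.
    + exact: finite_II.
    + by move=> *; exact: poweR_ge0.
    by rewrite -fsbig_ord.
  apply: (@le_trans _ _ (k%:E * \esum_(i in J) poweR (diam (U i)) s)%E).
    by apply: esum_mulrl_le => // i; exact: poweR_ge0.
  by rewrite EFinM lee_wpmul2l ?lee_fin.
Qed.

End refinement.

(** * Real powers and the cost of a single piece *)

Lemma powR_powRV {R : realType} (x a : R) : 0 <= x -> a != 0 ->
  (x `^ a^-1) `^ a = x.
Proof. by move=> x0 a0; rewrite -powRrM mulVf// powRr1. Qed.

Lemma powRV_powR {R : realType} (x a : R) : 0 <= x -> a != 0 ->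
  (x `^ a) `^ a^-1 = x.
Proof. by move=> x0 a0; rewrite -powRrM mulfV// powRr1. Qed.

(** As [u^al <= d], the ratio [u / d] is at most [u^(1 - al)], which leads to the power
    [u^(t - a (al - 1))]; since [u <= 1], lowering the exponent to [s] only increases it. The 4
    comes from [2 u / (d / 2)]. *)
Lemma large_piece_cost {R : realType} (C a al d u s t : R) :
  0 <= C -> 0 <= a -> 0 < d <= u -> u <= 1 -> u `^ al <= d -> 0 <= t ->
  s <= t - a * (al - 1) ->
  2 * C * (2 * u / (d / 2)) `^ a * d `^ t <= 2 * C * 4 `^ a * u `^ s.
Proof.
move=> C0 a0 /andP[d0 du] u1 uald t0 st.
have u0 : 0 < u := lt_le_trans d0 du.
rewrite -[leLHS]mulrA -[leRHS]mulrA.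
apply: ler_wpM2l; first by rewrite mulr_ge0.
have -> : 2 * u / (d / 2) = 4 * (u / d) by field; rewrite gt_eqF.
have ud0 : 0 <= u / d by rewrite divr_ge0// ltW.
rewrite powRM// -mulrA ler_wpM2l ?powR_ge0//.
have ud : u / d <= u `^ (1 - al).
  rewrite powRB ?(gt_eqF u0) ?implybT// [u `^ 1]powRr1 ?(ltW u0)//.
  apply: ler_wpM2l; first exact: ltW.
  by rewrite lef_pV2 ?posrE ?powR_gt0.
apply: (@le_trans _ _ ((u `^ (1 - al)) `^ a * u `^ t)).
  apply: ler_pM; [exact: powR_ge0|exact: powR_ge0| |].
    by apply: ge0_ler_powR; rewrite ?nnegrE ?powR_ge0.
  by apply: ge0_ler_powR; rewrite ?nnegrE ?(ltW u0) ?(ltW d0).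
rewrite -powRrM -powRD ?(gt_eqF u0) ?implybT//.
apply: ger_powR; first by rewrite u0.
lra.
Qed.

(** The left-hand base, which bounds the diameter of an enlarged piece, is [(1 + 1 / c) p1], and
    [p1 <= p^(1/al) <= u^(1/al)]; then [s <= t / al] and [u <= 1] conclude. *)
Lemma small_piece_cost {R : realType} (c al p p1 u s t : R) :
  0 < c -> 0 < al -> 0 < p <= u -> u <= 1 -> 0 <= p1 <= p `^ al^-1 -> 0 <= t ->
  s * al <= t -> (p1 + p1 / c) `^ t <= (1 + c^-1) `^ t * u `^ s.
Proof.
move=> c0 al0 /andP[p0 pu] u1 /andP[p10 p1p] t0 st.
have c1 : 0 <= 1 + c^-1 by rewrite addr_ge0// invr_ge0 ltW.
rewrite -[X in X + _]mulr1 -mulrDr mulrC powRM// ler_wpM2l ?powR_ge0//.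
have u0 : 0 < u := lt_le_trans p0 pu.
have p1u : p1 <= u `^ al^-1.
  apply: (le_trans p1p); apply: ge0_ler_powR;
    by rewrite ?nnegrE ?invr_ge0 ?(ltW al0) ?(ltW p0) ?(ltW u0).
apply: (@le_trans _ _ ((u `^ al^-1) `^ t)).
  by apply: ge0_ler_powR; rewrite ?nnegrE ?powR_ge0.
rewrite -powRrM; apply: ger_powR; first by rewrite u0.
by rewrite mulrC ler_pdivlMr.
Qed.

(** * Refinement of a piece under the root bound *)

Lemma poweR_diam_le {R : realType} {X : metricType R} (U : set X) (d t : R) :
  0 <= d -> 0 <= t -> (diam U <= d%:E)%E -> (poweR (diam U) t <= (d `^ t)%:E)%E.
Proof.
move=> d0 t0 Ud; rewrite -poweR_EFin; apply: gt0_ler_poweR => //.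
- by rewrite in_itv/= diam_ge0 leey.
- by rewrite in_itv/= lee_fin d0 leey.
Qed.

(** This restates that [Phi d / d] tends to 0; it leaves room at scale [d] for the enlargement of a
    piece. *)
Lemma adm_small {R : realType} (Phi : admissible R) (e : R) : 0 < e ->
  exists2 D : R, 0 < D & forall d, 0 < d < D -> 0 < Phi d <= e * d.
Proof.
move=> e0; have /cvgrPdist_lt/(_ e e0) := @adm_cvg _ Phi.
move=> [D /= D0 PhiD]; exists (Num.min D (adm_bound Phi)).
  by rewrite lt_min D0 adm_bound_gt0.
move=> d /andP[d0]; rewrite lt_min => /andP[dD dB].
have d0B : 0 < d < adm_bound Phi by rewrite d0.
have /andP[Phi0 _] := adm_itv d0B.
have := PhiD d; rewrite /ball_ /= !sub0r !normrN !gtr0_norm ?divr_gt0//.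
move=> /(_ dD d0); rewrite ltr_pdivrMr// => Phid.
by rewrite Phi0 ltW.
Qed.

(** The constant adds up those of the three cases: 1 for a kept piece, the second term for a large
    one, the third for a small one. *)
Lemma refinable_root_bound {R : realType} {X : metricType R} (F : set X)
    (Phi Phi1 : admissible R) (c C a al s t d : R) :
  0 < c < 1 ->
  (forall (x : X) r, 0 < r -> (r%:E < diam [set: X])%E ->
     ball x r `\` ball x (c * r) !=set0) ->
  0 < C -> 0 <= a ->
  (forall (x : X) r r', F x -> 0 < r -> r < r' ->
     (covering_number r (ball x r' `&` F) <= (C * (r' / r) `^ a)%:E)%E) ->
  1 < al -> 0 <= t -> s <= t - a * (al - 1) -> s * al <= t ->
  0 < d < 1 -> ((d / 2)%:E < diam [set: X])%E ->
  0 < Phi1 d <= c * (d / 2) -> 0 < Phi (d `^ al^-1) ->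
  Phi1 d <= Phi (d `^ al^-1) `^ al^-1 ->
  forall U, ((Phi (d `^ al^-1))%:E <= diam U <= (d `^ al^-1)%:E)%E ->
    refinable Phi1 F d s t (1 + 2 * C * 4 `^ a + (1 + c^-1) `^ t) U.
Proof.
move=> /andP[c0 c1] Xc C0 a0 Ca al1 t0 st sal /andP[d0 d1] dX /andP[p10 p1c].
move=> p0 p1p U /andP[pU Ud].
have al0 : 0 < al by exact: lt_trans al1.
have U0 : U !=set0 by apply: diam_gt0_nonempty; exact: lt_le_trans pU.
case DU : (diam U) pU Ud => [u| |] // => pu ud; rewrite !lee_fin in pu ud.
have u0 : 0 < u by exact: lt_le_trans pu.
have u1 : u <= 1.
  rewrite (le_trans ud)//; have -> : 1 = 1 `^ al^-1 by rewrite powR1.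
  apply: ge0_ler_powR;
    by rewrite ?nnegrE ?invr_ge0 ?(ltW al0) ?(ltW d0) ?(ltW d1).
have us0 : 0 <= u `^ s by exact: powR_ge0.
have K1 : 0 <= 2 * C * 4 `^ a by rewrite mulr_ge0 ?powR_ge0 ?mulr_ge0 ?(ltW C0).
have K2 : 0 <= (1 + c^-1) `^ t by exact: powR_ge0.
have Kle k : k <= 1 \/ k <= 2 * C * 4 `^ a \/ k <= (1 + c^-1) `^ t ->
    k * u `^ s <= (1 + 2 * C * 4 `^ a + (1 + c^-1) `^ t) * u `^ s.
  by move=> kK; apply: ler_wpM2r => //; lra.
have sub1 (V : set X) : U `<=` V -> U `&` F `<=` \bigcup_(j in `I_1) V.
  by move=> UV x [Ux _]; exists 0%N => //; exact: UV.
have p1d : Phi1 d <= d / 2 by nra.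
(* With the previous bound, a set of diameter below [Phi1 d] stays within diameter [d] once
   enlarged. *)
have p1cd : Phi1 d / c <= d / 2 by rewrite ler_pdivrMr// mulrC.
have [du|ud1] := ltP d u.
(* Balls of radius [d / 4] have diameter at most [d / 2]; with [rho = c d / 2] the enlargement adds
   at most [rho / c = d / 2], for a total of at most [d]. *)
- have [|||n [f [nM Uf]]] := assouad_cover C a F U u (d / 2) C0 Ca _ _ U0 _.
  + by rewrite divr_gt0.
  + lra.
  + by rewrite DU.
  have rhoE : c * (d / 2) / c = d / 2 by rewrite mulrAC divff ?mul1r ?gt_eqF.
  have /choice[V VP] j : exists V, ball (f j) (d / 2 / 2) `<=` V /\
      ((c * (d / 2))%:E <= diam V <= d%:E)%E.
    have [||||V BV] := uniformly_perfect_enlarge c (ball (f j) (d / 2 / 2))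
      (d / 2) (c * (d / 2)) c0 Xc _ _ _ _.
    * by rewrite mulr_gt0// divr_gt0.
    * by rewrite rhoE.
    * by exists (f j); rewrite ballEmdist/= mdistxx !divr_gt0.
    * by apply: diam_ball; rewrite divr_ge0// ltW.
    by rewrite rhoE -splitr => Vd; exists V.
  exists n, V; split.
  + by move=> x /Uf[j jn fjx]; exists j => //; have [+ _] := VP j; apply.
  + move=> j _; have [_ /andP[Vd ->]] := VP j.
    by rewrite andbT (le_trans _ Vd)// lee_fin.
  + apply: (@le_trans _ _ (\sum_(j < n) (d `^ t)%:E)%E).
      apply: lee_sum => j _; have [_ /andP[_ Vd]] := VP j.
      by apply: poweR_diam_le => //; exact: ltW.
    rewrite sumEFin sumr_const card_ord DU poweR_EFin -EFinM lee_fin.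
    rewrite -[_ *+ n]mulr_natl.
    apply: (le_trans _ (Kle _ (or_intror (or_introl (lexx _))))).
    apply: (@le_trans _ _ (2 * C * (2 * u / (d / 2)) `^ a * d `^ t)).
      by rewrite ler_wpM2r ?powR_ge0.
    apply: (large_piece_cost C a al) => //; first exact: ltW.
    * by rewrite d0 ltW.
    * rewrite -[leRHS](powR_powRV d al) ?(gt_eqF al0) ?(ltW d0)//.
      by apply: ge0_ler_powR; rewrite ?nnegrE ?powR_ge0 ?(ltW al0) ?(ltW u0).
have [p1u|up1] := leP (Phi1 d) u.
- exists 1%N, (fun=> U); split; first exact: sub1.
  + by move=> _ _; rewrite DU !lee_fin p1u.
  + rewrite big_ord1 DU !poweR_EFin -EFinM lee_fin.
    apply: (le_trans _ (Kle _ (or_introl (lexx _)))).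
    (* Here [s <= t] because [a (al - 1) >= 0]. *)
    rewrite mul1r; apply: ger_powR; first by rewrite u0.
    nra.
have [||V UV] := uniformly_perfect_enlarge c U u (Phi1 d) c0 Xc p10 _ U0 _.
- by apply: le_lt_trans dX; rewrite lee_fin.
- by rewrite DU.
move=> /andP[p1V Vp1].
have VD : (diam V <= (Phi1 d + Phi1 d / c)%:E)%E.
  by rewrite (le_trans Vp1)// lee_fin lerD2r ltW.
exists 1%N, (fun=> V); split; first exact: sub1.
- move=> _ _; rewrite p1V (le_trans VD)// lee_fin; lra.
- rewrite big_ord1 DU.
  apply: (@le_trans _ _ (((Phi1 d + Phi1 d / c) `^ t)%:E)).
    apply: poweR_diam_le => //.
    by rewrite addr_ge0 ?divr_ge0 ?(ltW p10) ?(ltW c0).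
  rewrite poweR_EFin -EFinM lee_fin.
  apply: (le_trans _ (Kle _ (or_intror (or_intror (lexx _))))).
  apply: (small_piece_cost c al (Phi (d `^ al^-1))) => //.
  + by rewrite p0.
  + by rewrite (ltW p10).
Qed.

(** * Infima of exponents, and monotonicity of admissible functions *)

(** An infimum does not notice the passage from [s] to every [t > s]; this gap is what the change of
    scale consumes. *)
Lemma ereal_inf_EFin_le {R : realType} (A B : set R) :
  (forall s t, A s -> s < t -> B t) ->
  (ereal_inf [set s%:E | s in B] <= ereal_inf [set s%:E | s in A])%E.
Proof.
move=> AB; apply: le_ereal_inf_tmp => _ [s As <-].
apply/lee_addgt0Pr => e e0; apply: ereal_inf_lbound.
by exists (s + e) => //; apply: AB As _; rewrite ltrDl.
Qed.

Lemma powR_lt {R : realType} (x y a : R) : 0 < a -> 0 < x < y `^ a^-1 ->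
  0 < y -> x `^ a < y.
Proof.
move=> a0 /andP[x0 xy] y0; rewrite -[y](powR_powRV y a) ?(ltW y0) ?gt_eqF//.
by apply: gt0_ltr_powR => //; rewrite nnegrE ?powR_ge0// ltW.
Qed.

Lemma powRV_lt {R : realType} (x y a : R) : 0 < a -> 0 < x < y `^ a ->
  0 < y -> x `^ a^-1 < y.
Proof. by move=> a0 xy; apply: powR_lt; rewrite ?invr_gt0 ?invrK. Qed.

Section admissible_theory.
Context {R : realType} (Phi : admissible R).

Lemma adm_domE d : adm_dom Phi d = (0 < d < adm_bound Phi) :> Prop.
Proof. by rewrite /adm_dom/= in_itv/=. Qed.

Lemma adm_gt0 d : adm_dom Phi d -> 0 < Phi d.
Proof. by rewrite adm_domE => /adm_itv/andP[]. Qed.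

Lemma adm_le d : adm_dom Phi d -> Phi d <= d.
Proof. by rewrite adm_domE => /adm_itv/andP[]. Qed.

(* A nonincreasing positive function is not bounded by [d] as [d] tends to 0. *)
Lemma adm_nondecreasing d e :
  adm_dom Phi d -> adm_dom Phi e -> d <= e -> Phi d <= Phi e.
Proof.
move=> Dd De de; have [|noninc] := adm_monotonic Phi.
  by apply.
have e0 := adm_gt0 _ De; have := De; rewrite adm_domE => /andP[egt0 eB].
(* At this point [Phi x <= x < Phi e], against [Phi e <= Phi x]. *)
pose x := Num.min e (Phi e / 2).
have x0 : 0 < x by rewrite lt_min egt0 divr_gt0.
have xe : x <= e by rewrite ge_min lexx.
have Dx : adm_dom Phi x by rewrite adm_domE x0 (le_lt_trans xe).
have := adm_le _ Dx; have := noninc _ _ De Dx xe.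
have : x <= Phi e / 2 by rewrite ge_min lexx orbT.
lra.
Qed.

End admissible_theory.

(** * Transfer of covers between scales and comparison of dimensions *)

Lemma has_cover_transfer {R : realType} {X : metricType R} (F : set X)
    (Phi Phi1 : admissible R) (s t : R) :
  uniformly_perfect X -> (exists x y : X, x <> y) -> (assouad_dim F < +oo)%E ->
  0 <= s -> s < t ->
  exists al k D, [/\ 1 < al, 0 < k, 0 < D &
    forall d eps, 0 < d < D -> root_bound Phi1 Phi al d ->
      has_cover Phi F (d `^ al^-1) s eps -> has_cover Phi1 F d t (k * eps)].
Proof.
move=> [c c01 Xc] [x [y /eqP xy]].
move=> /ereal_inf_lt[_ [a' [C C0 Ca']] _] _ s0 st.
have t0 : 0 < t by exact: le_lt_trans st.
(* As [r' / r > 1], the exponent may be raised to a nonnegative one. *)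
pose a := Num.max 0 a'.
have a0 : 0 <= a by rewrite le_max lexx.
have Ca (z : X) (r r' : R) : F z -> 0 < r -> r < r' ->
    (covering_number r (ball z r' `&` F) <= (C * (r' / r) `^ a)%:E)%E.
  move=> Fz r0 rr'; apply: le_trans (Ca' z r r' Fz r0 rr') _.
  rewrite lee_fin ler_pM2l//; apply: ler_powR.
    by rewrite ler_pdivlMr// mul1r ltW.
  by rewrite le_max lexx orbT.
(* Chosen so that [a eta] and [s eta] are both at most [t - s], which are the two conditions on
   [al = 1 + eta]. *)
pose eta := (t - s) / (1 + a + t).
have eta_def : eta * (1 + a + t) = t - s by rewrite divfK ?gt_eqF//; lra.
have eta0 : 0 < eta by rewrite divr_gt0//; lra.
have c0 : 0 < c by case/andP: c01.
have c2 : 0 < c / 2 by rewrite divr_gt0.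
have [D0 D00 D0P] := adm_small Phi1 (c / 2) c2.
have xy0 : 0 < mdist x y by rewrite mdist_gt0.
exists (1 + eta), (1 + 2 * C * 4 `^ a + (1 + c^-1) `^ t).
(* Below [D0] one has [Phi1 d <= c d / 2]; below the distance of two distinct points, [d / 2] is
   smaller than the diameter of the space. *)
exists (Num.min 1 (Num.min D0 (mdist x y))); split.
- by rewrite ltrDl.
- by rewrite !addr_gt0 ?mulr_gt0 ?powR_gt0 ?addr_gt0 ?invr_gt0.
- by rewrite !lt_min ltr01 D00.
move=> d eps /andP[d0]; rewrite !lt_min => /and3P[d1 dD0 dxy] [_ Dd' Phid].
have /andP[p10 p1c] : 0 < Phi1 d <= c / 2 * d.
  by apply: D0P; rewrite d0.
apply: has_cover_refine.
  by rewrite !addr_ge0 ?mulr_ge0 ?powR_ge0 ?(ltW C0).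
apply: (refinable_root_bound _ _ _ c C a (1 + eta)) => //.
- by rewrite ltrDl.
- exact: ltW.
- nra.
- nra.
- by rewrite d0.
- apply: lt_le_trans (mdist_le_diam _ x y I I); rewrite lte_fin; lra.
- rewrite p10; lra.
- exact: adm_gt0.
Qed.

(** For the upper dimension, a small [d] is served by the cover for [Phi] at scale [d^(1/al)]. For
    the lower one, a good scale [d'] of [Phi] yields the scale [d'^al] of [Phi1]. Aiming at cost
    [eps / k] absorbs the factor [k]. *)
Lemma root_bound_dim_preceq {R : realType} (Phi1 Phi : admissible R) :
  (forall a : R, 1 < a -> exists2 D : R, 0 < D &
     forall d : R, 0 < d < D -> root_bound Phi1 Phi a d) ->
  dim_preceq Phi1 Phi.
Proof.
move=> H X Xup X2 F F0 Ftb FA; split.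
- apply: ereal_inf_EFin_le => s t [s0 Hs] st.
  split; first by rewrite (le_trans s0)// ltW.
  have [al [k [D [al1 k0 D0 HD]]]] :=
    has_cover_transfer F Phi Phi1 s t Xup X2 FA s0 st.
  move=> eps eps0; have al0 : 0 < al by exact: lt_trans al1.
  have [d0 [/andP[d00 d01] _ Hd0]] := Hs (eps / k) (divr_gt0 eps0 k0).
  have [D1 D10 HD1] := H al al1.
  exists (Num.min 1 (Num.min (adm_bound Phi1)
           (Num.min D (Num.min D1 (d0 `^ al))))); split.
  + by rewrite !lt_min ltr01 adm_bound_gt0 D0 D10 powR_gt0// ge_min lexx.
  + move=> d /=; rewrite in_itv/= !lt_min => /and5P[d'0 _ dB _ _].
    by rewrite adm_domE d'0.
  + move=> d; rewrite !lt_min => /andP[d'0 /and5P[_ _ dD dD1 dd0]].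
    have -> : eps = k * (eps / k) by rewrite mulrC divfK ?gt_eqF.
    apply: HD; rewrite ?d'0//; first by apply: HD1; rewrite d'0.
    by apply: Hd0; rewrite powR_gt0//= powRV_lt// d'0.
- apply: ereal_inf_EFin_le => s t [s0 Hs] st.
  split; first by rewrite (le_trans s0)// ltW.
  have [al [k [D [al1 k0 D0 HD]]]] :=
    has_cover_transfer F Phi Phi1 s t Xup X2 FA s0 st.
  move=> eps d0 eps0 /andP[d00 d01]; have al0 : 0 < al by exact: lt_trans al1.
  have [D1 D10 HD1] := H al al1.
  (* A scale [d'] below [E^(1/al)] puts [d'^al] below all three thresholds. *)
  pose E := Num.min d0 (Num.min D D1).
  have E0 : 0 < E by rewrite !lt_min d00 D0.
  have [||d' [/andP[d'0 d'E] _ Hd']] :=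
      Hs (eps / k) (Num.min 1 (E `^ al^-1)).
  + by rewrite divr_gt0.
  + by rewrite lt_min ltr01 powR_gt0//= ge_min lexx.
  have : d' `^ al < E.
    by apply: powR_lt => //; rewrite d'0 (lt_le_trans d'E)// ge_min lexx orbT.
  rewrite !lt_min => /and3P[dd0 dD dD1].
  have d0' : 0 < d' `^ al by exact: powR_gt0.
  have rb : root_bound Phi1 Phi al (d' `^ al) by apply: HD1; rewrite d0'.
  exists (d' `^ al); split; first by rewrite d0'.
    by case: rb.
  have -> : eps = k * (eps / k) by rewrite mulrC divfK ?gt_eqF.
  apply: HD => //; first by rewrite d0'.
  by rewrite powRV_powR ?gt_eqF ?(ltW d'0).
Qed.

(** Covers for [Phi] exist at every small scale, so one arbitrarily small [d] with the root bound
    suffices. *)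
Lemma root_bound_lower_le_upper {R : realType} (Phi1 Phi : admissible R)
    (X : metricType R) (F : set X) :
  (forall a d0 : R, 1 < a -> 0 < d0 ->
     exists2 d : R, 0 < d < d0 & root_bound Phi1 Phi a d) ->
  uniformly_perfect X -> (exists x y : X, x <> y) -> (assouad_dim F < +oo)%E ->
  (lower_dim Phi1 F <= upper_dim Phi F)%E.
Proof.
move=> H Xup X2 FA; apply: ereal_inf_EFin_le => s t [s0 Hs] st.
split; first by rewrite (le_trans s0)// ltW.
have [al [k [D [al1 k0 D0 HD]]]] :=
  has_cover_transfer F Phi Phi1 s t Xup X2 FA s0 st.
move=> eps d0 eps0 /andP[d00 d01]; have al0 : 0 < al by exact: lt_trans al1.
have [e0 [/andP[e00 _] _ He0]] := Hs (eps / k) (divr_gt0 eps0 k0).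
have [|d /andP[d'0]] := H al (Num.min d0 (Num.min D (e0 `^ al))) al1.
  by rewrite !lt_min d00 D0 powR_gt0.
rewrite !lt_min => /and3P[dd0 dD de0] rb.
exists d; split; first by rewrite d'0.
  by case: rb.
have -> : eps = k * (eps / k) by rewrite mulrC divfK ?gt_eqF.
apply: HD => //; first by rewrite d'0.
by apply: He0; rewrite powR_gt0//= powRV_lt// d'0.
Qed.

(** * Sufficient conditions for the root bound *)

(** At [d = e^(1/a)] the power bound reads [(Phi e)^a <= Phi1 (e^(1/a))]; take a-th roots. *)
Lemma power_bound_root_bound {R : realType} (Phi Phi1 : admissible R)
    (a e : R) :
  0 < a -> 0 < e -> power_bound Phi Phi1 a (e `^ a^-1) ->
  root_bound Phi Phi1 a e.
Proof.
move=> a0 e0 []; rewrite powR_powRV ?gt_eqF ?(ltW e0)// => De De' Phie.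
split => //; rewrite -[Phi e](powRV_powR _ a) ?gt_eqF ?(ltW (adm_gt0 _ _ De))//.
by apply: ge0_ler_powR => //;
  rewrite ?nnegrE ?invr_ge0 ?powR_ge0 ?(ltW a0) ?(ltW (adm_gt0 _ _ De')).
Qed.

(* With e = d^(1/a) and p = Phi e, for small d both d / C <= e and
   M * p <= p^(1/a), so Phi1 d <= M * Phi (d / C) <= M * p <= p^(1/a). *)
Lemma limf_esup_root_bound {R : realType} (Phi1 Phi : admissible R) (C a : R) :
  0 < C ->
  (limf_esup (fun d : R => (Phi1 (C * d) / Phi d)%:E) 0^'+ < +oo)%E ->
  1 < a ->
  exists2 D : R, 0 < D & forall d, 0 < d < D -> root_bound Phi1 Phi a d.
Proof.
move=> C0 /ereal_inf_lt[_ [V V0 <-] supV] a1.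
have [M M0 HM] : exists2 M, 0 < M & forall d, V d -> Phi1 (C * d) / Phi d <= M.
  (* The supremum is not +oo, and not -oo once [V] has a point, so [fine] returns its true value;
     the maximum with 1 makes [M] positive. *)
  exists (Num.max 1 (fine (ereal_sup
    [set (Phi1 (C * d) / Phi d)%:E | d in V]))).
    by rewrite lt_max ltr01.
  move=> d Vd; rewrite le_max; apply/orP; right.
  have Vle : ((Phi1 (C * d) / Phi d)%:E <=
      ereal_sup [set (Phi1 (C * d) / Phi d)%:E | d in V])%E.
    by apply: ereal_sup_ubound; exists d.
  by move: supV Vle; case: ereal_sup.
have [D0 /= D00 VD0] := V0.
have a0 : 0 < a by exact: lt_trans a1.
have b1 : 0 < 1 - a^-1 by rewrite subr_gt0 invf_lt1.
have a10 : 0 < a - 1 by rewrite subr_gt0.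
(* For [e = d^(1/a)], the second term gives [e^(a - 1) < C], hence [d = e^a <= C e]; the third gives
   [(Phi e)^(1 - 1/a) < 1 / M], as [Phi e <= e]. *)
pose E := Num.min (adm_bound Phi)
  (Num.min (C `^ (a - 1)^-1) (M^-1 `^ (1 - a^-1)^-1)).
have E0 : 0 < E by rewrite !lt_min adm_bound_gt0 !powR_gt0 ?invr_gt0.
exists (Num.min (adm_bound Phi1) (Num.min (C * D0)
          (Num.min (C * adm_bound Phi) (E `^ a)))).
  by rewrite !lt_min adm_bound_gt0 !mulr_gt0 ?adm_bound_gt0 ?powR_gt0.
move=> d /andP[d0]; rewrite !lt_min => /and4P[dB1 dD0 dB dE].
pose e := d `^ a^-1.
have e0 : 0 < e by exact: powR_gt0.
have : e < E by apply: powRV_lt; rewrite ?d0.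
rewrite !lt_min => /and3P[eB eC eM].
have De : adm_dom Phi e by rewrite adm_domE e0.
have DdC : adm_dom Phi (d / C).
  by rewrite adm_domE divr_gt0//= ltr_pdivrMr// mulrC.
have dCe : d / C <= e.
  rewrite ler_pdivrMr// -[leLHS](powR_powRV d a) ?gt_eqF ?(ltW d0)// -/e.
  rewrite -mulr_powRB1 ?(ltW e0)// ler_pM2l// ltW//.
  by apply: powR_lt => //; rewrite e0.
split => //; first by rewrite adm_domE d0.
have Phi1d : Phi1 d <= M * Phi (d / C).
  rewrite -ler_pdivrMr ?adm_gt0//.
  have := HM (d / C); rewrite [C * _]mulrC divfK ?gt_eqF//; apply.
  apply: VD0; rewrite ?divr_gt0// /ball_/= sub0r normrN gtr0_norm ?divr_gt0//.
  by rewrite ltr_pdivrMr// mulrC.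
have p0 := adm_gt0 _ _ De.
apply: (le_trans Phi1d); apply: (@le_trans _ _ (M * Phi e)).
  by rewrite ler_pM2l// adm_nondecreasing.
have {1}-> : Phi e = Phi e `^ (1 - a^-1) * Phi e `^ a^-1.
  by rewrite -powRD ?(gt_eqF p0) ?implybT// subrK powRr1// ltW.
rewrite mulrA ler_piMl ?powR_ge0//.
rewrite -[leRHS](mulfV (lt0r_neq0 M0)) ler_pM2l// ltW//; apply: powR_lt => //.
  by rewrite p0 (le_lt_trans (adm_le _ _ De)).
by rewrite invr_gt0.
Qed.

Theorem corollary3p8 (R : realType) (Phi Phi1 : admissible R) :
  (* (i) *)
  [/\ (exists2 C : R, 0 < C &
         (limf_esup (fun d : R => (Phi1 (C * d) / Phi d)%:E) 0^'+ < +oo)%E) ->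
      (forall a : R, 1 < a -> exists2 D : R, 0 < D &
         forall d : R, 0 < d < D -> root_bound Phi1 Phi a d),
      (forall a : R, 1 < a -> exists2 D : R, 0 < D &
         forall d : R, 0 < d < D -> root_bound Phi1 Phi a d) ->
      dim_preceq Phi1 Phi &
      (forall a d0 : R, 1 < a -> 0 < d0 ->
         exists2 d : R, 0 < d < d0 & root_bound Phi1 Phi a d) ->
      forall X : metricType R, uniformly_perfect X ->
      (exists x y : X, x <> y) ->
      forall F : set X, F !=set0 -> totally_bounded F ->
        (assouad_dim F < +oo)%E ->
        (lower_dim Phi1 F <= upper_dim Phi F)%E]
  /\
  (* (ii) *)
  ((forall a : R, 1 < a -> exists2 D : R, 0 < D &
      forall d : R, 0 < d < D ->
        power_bound Phi Phi1 a d /\ root_bound Phi1 Phi a d) ->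
   dim_equiv Phi Phi1).
Proof.
split; first split.
- move=> [C C0 HC] a a1; exact: limf_esup_root_bound HC a1.
- exact: root_bound_dim_preceq.
- by move=> H X Xup X2 F _ _ FA; exact: root_bound_lower_le_upper.
- move=> H; split; apply: root_bound_dim_preceq => a a1; last first.
    by have [D D0 HD] := H a a1; exists D => // d /HD[].
  have [D D0 HD] := H a a1; have a0 : 0 < a by exact: lt_trans a1.
  (* The power bound is used at [d^(1/a)], which is below [D] when [d < D^a]. *)
  exists (D `^ a) => [|d /andP[d0 dD]]; first exact: powR_gt0.
  apply: power_bound_root_bound => //.
  have [] // := HD (d `^ a^-1).
  by rewrite powR_gt0// powRV_lt// d0.
Qed.
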